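(* Let $\mathbf{A}\in\mathbb{R}^{m\times n}$ be nonzero and $b\in\mathbb{R}^m$ be such that the linear system $\mathbf{A}x=b$ is consistent, with solution set $\mathcal{L}=\{x\in\mathbb{R}^n:\mathbf{A}x=b\}$. Let $\mathcal{D}$ be a distribution over random matrices $\mathbf{S}$ (with $m$ rows), and consider the stochastic optimization reformulation $\min_{x\in\mathbb{R}^n}f(x):=\mathbb{E}_{\mathbf{S}\sim\mathcal{D}}[f_{\mathbf{S}}(x)]$ of the linear system, whose set of minimizers is $\mathcal{X}^*=\mathcal{L}$. Let $x^*$ be the Euclidean projection of $x^0$ onto $\mathcal{X}^*=\mathcal{L}$. Then SGD with SPS with $c=1/2$ applied to this reformulation satisfies, for all $k\ge0$, $$\mathbb{E}\|x^{k}-x^*\|^2\le\left(1-\lambda_{\min}^+(\mathbf{W})\right)^k\|x^0-x^*\|^2,$$ where $\lambda_{\min}^+(\mathbf{W})$ is the smallest nonzero eigenvalue of $\mathbf{W}=\mathbb{E}_{\mathbf{S}\sim\mathcal{D}}[\mathbf{A}^\top\mathbf{H}\mathbf{A}]$.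
   Context: For a random matrix $\mathbf{S}\sim\mathcal{D}$ define $\mathbf{H}:=\mathbf{S}(\mathbf{S}^\top\mathbf{A}\mathbf{A}^\top\mathbf{S})^\dagger\mathbf{S}^\top$, where $\dagger$ is the Moore-Penrose pseudoinverse, and $$f_{\mathbf{S}}(x):=\tfrac12(\mathbf{A}x-b)^\top\mathbf{H}(\mathbf{A}x-b).$$ It is a standing assumption on the reformulation (i.e. on $\mathcal{D}$) that it is equivalent to the linear system: the set $\mathcal{X}^*$ of minimizers of $f$ equals $\mathcal{L}$. SGD: starting from a deterministic $x^0\in\mathbb{R}^n$, at each iteration $k$ a matrix $\mathbf{S}_k\sim\mathcal{D}$ is drawn independently of the past, and $x^{k+1}=x^k-\gamma_k\nabla f_{\mathbf{S}_k}(x^k)$. SPS with $c=1/2$: $\gamma_k=\frac{2\left[f_{\mathbf{S}_k}(x^k)-f_{\mathbf{S}_k}^*\right]}{\|\nabla f_{\mathbf{S}_k}(x^k)\|^2}$, where $f_{\mathbf{S}}^*=\inf_xf_{\mathbf{S}}(x)=0$. If $\nabla f_{\mathbf{S}_k}(x^k)=0$ then $x^{k+1}=x^k$. *)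

(* Defs.v *)
From HB Require Import structures.
From mathcomp Require Import all_boot all_order all_algebra.
From mathcomp Require Import all_classical all_reals all_analysis.

Set Implicit Arguments.
Unset Strict Implicit.
Unset Printing Implicit Defensive.

Import Order.TTheory GRing.Theory Num.Theory.
Import numFieldNormedType.Exports.

Local Open Scope classical_set_scope.
Local Open Scope ring_scope.

(* The library norm on matrices is the sup norm, whence [enorm] for the
   Euclidean norm. *)
Definition enorm (R : realType) (n : nat) (x : 'cV[R]_n) : R :=
  Num.sqrt (\sum_(i < n) x i 0 ^+ 2).

Definition gradient (R : realType) (n : nat) (g : 'cV[R]_n -> R)
    (x : 'cV[R]_n) : 'cV[R]_n :=
  \col_(i < n) 'D_(delta_mx i 0) g x.

Definition is_pinv (R : realType) (m n : nat) (M : 'M[R]_(m, n))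
    (X : 'M[R]_(n, m)) : Prop :=
  [/\ M *m X *m M = M, X *m M *m X = X,
      (M *m X)^T = M *m X & (X *m M)^T = X *m M].

(* Moore-Penrose pseudoinverse: the unique solution of the four Penrose
   equations, see [mp_pinvP] and [is_pinv_unique] below; the default value 0 of
   [xget] is thus never used. It differs in general from [pinvmx]. *)
Definition mp_pinv (R : realType) (m n : nat) (M : 'M[R]_(m, n)) :
    'M[R]_(n, m) :=
  xget 0 [set X | is_pinv M X].

Lemma is_pinv_unique (R : realType) (m n : nat) (M : 'M[R]_(m, n))
    (X Y : 'M[R]_(n, m)) : is_pinv M X -> is_pinv M Y -> X = Y.
Proof.
move=> [X1 X2 X3 X4] [Y1 Y2 Y3 Y4].
have MXY : M *m X = M *m Y.
  rewrite -X3 -{1}Y1 -(mulmxA (M *m Y)) trmx_mul X3 Y3.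
  by rewrite mulmxA X1.
have XYM : X *m M = Y *m M.
  rewrite -X4 -{1}Y1 -(mulmxA M) mulmxA trmx_mul X4 Y4.
  by rewrite -!mulmxA (mulmxA M X M) X1.
by rewrite -X2 XYM -mulmxA MXY mulmxA Y2.
Qed.

Lemma gram_unit (R : realType) (m n : nat) (B : 'M[R]_(m, n)) :
  row_free B -> B *m B^T \in unitmx.
Proof.
move=> fB; rewrite -row_free_unit; apply: inj_row_free => v vBB.
have : (v *m B) *m (v *m B)^T = 0.
  by rewrite trmx_mul mulmxA -(mulmxA v) vBB mul0mx.
move=> /matrixP /(_ 0 0); rewrite !mxE => /eqP.
under eq_bigr => j _ do rewrite [(_^T) _ _]mxE -expr2.
rewrite psumr_eq0 => [/allP vB0|j _]; last exact: sqr_ge0.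
suff vB : v *m B = 0 by apply: (row_free_inj fB); rewrite vB mul0mx.
apply/rowP => j; rewrite [RHS]mxE; apply/eqP; rewrite -(@sqrf_eq0 R).
by apply: vB0; rewrite mem_index_enum.
Qed.

Lemma is_pinv_factor (R : realType) (m n r : nat) (C : 'M[R]_(m, r))
    (F : 'M[R]_(r, n)) : row_free C^T -> row_free F ->
  is_pinv (C *m F)
    (F^T *m invmx (F *m F^T) *m invmx (C^T *m C) *m C^T).
Proof.
move=> /gram_unit; rewrite trmxK => uV /gram_unit uU.
set U := F *m F^T in uU *; set V := C^T *m C in uV *.
have sU : (invmx U)^T = invmx U by rewrite trmx_inv /U trmx_mul trmxK.
have sV : (invmx V)^T = invmx V by rewrite trmx_inv /V trmx_mul trmxK.
set X := F^T *m _ *m _ *m _.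
have MX : C *m F *m X = C *m invmx V *m C^T.
  by rewrite /X !mulmxA -(mulmxA C F) -/U -(mulmxA C U) mulmxV // mulmx1.
have XM : X *m (C *m F) = F^T *m invmx U *m F.
  rewrite /X !mulmxA -(mulmxA _ C^T) -/V -(mulmxA _ (invmx V)).
  by rewrite mulVmx // mulmx1.
split.
- rewrite MX !mulmxA -(mulmxA _ C^T) -/V -(mulmxA _ (invmx V)).
  by rewrite mulVmx // mulmx1.
- rewrite XM /X !mulmxA -(mulmxA _ F) -/U -(mulmxA _ (invmx U) U).
  by rewrite mulVmx // mulmx1.
- by rewrite MX !trmx_mul trmxK sV mulmxA.
- by rewrite XM !trmx_mul trmxK sU mulmxA.
Qed.

Lemma is_pinv_exists (R : realType) (m n : nat) (M : 'M[R]_(m, n)) :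
  exists X, is_pinv M X.
Proof.
rewrite -(mulmx_base M); eexists; apply: is_pinv_factor.
- by rewrite /row_free mxrank_tr; exact: col_base_full.
- exact: row_base_free.
Qed.

Lemma mp_pinvP (R : realType) (m n : nat) (M : 'M[R]_(m, n)) :
  is_pinv M (mp_pinv M).
Proof. exact: (xgetPex 0 (is_pinv_exists M)). Qed.

(* Matrices with m rows and any number of columns, so that under a distribution
   on [sketch R m] the number of columns of S may itself be random. The
   topology is the disjoint union topology, and the sigma-algebra on
   [sketch_space] its Borel sigma-algebra. *)
Definition sketch (R : realType) (m : nat) := {q : nat & 'M[R]_(m, q)}.

HB.instance Definition _ (R : realType) (m : nat) :=
  Topological.copy (sketch R m)
    {q : nat & ('M[R]_(m, q) : topologicalType)}.
HB.instance Definition _ (R : realType) (m : nat) :=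
  isPointed.Build (sketch R m) (existT (fun q => 'M[R]_(m, q)) 0%N 0 : {q : nat & 'M[R]_(m, q)}).

Definition sketch_space (R : realType) (m : nat) :=
  g_sigma_algebraType (@open (sketch R m)).

Section reformulation.
Context (R : realType) (m n : nat) (A : 'M[R]_(m, n)) (b : 'cV[R]_m).

Definition solution_set : set 'cV[R]_n := [set x | A *m x = b].

Definition Hmx (S : sketch R m) : 'M[R]_m :=
  let M := projT2 S in M *m mp_pinv (M^T *m A *m A^T *m M) *m M^T.

Definition fS (S : sketch R m) (x : 'cV[R]_n) : R :=
  2^-1 * ((A *m x - b)^T *m Hmx S *m (A *m x - b)) 0 0.

Definition fS_inf (S : sketch R m) : R := inf (range (fS S)).

Definition fobj (D : probability (sketch_space R m) R) (x : 'cV[R]_n) :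
    \bar R :=
  'E_D[fun S => fS S x].

(* A^T H A is an orthogonal projector, so its entries are bounded and [fine] is
   applied to finite expectations only. *)
Definition Wmx (D : probability (sketch_space R m) R) : 'M[R]_n :=
  \matrix_(i < n, j < n) fine 'E_D[fun S => (A^T *m Hmx S *m A) i j].

Definition sps_stepsize (S : sketch R m) (x : 'cV[R]_n) : R :=
  2 * (fS S x - fS_inf S) / enorm (gradient (fS S) x) ^+ 2.

Definition sgd_step (S : sketch R m) (x : 'cV[R]_n) : 'cV[R]_n :=
  if gradient (fS S) x == 0 then x
  else x - sps_stepsize S x *: gradient (fS S) x.

Fixpoint sgd (x0 : 'cV[R]_n) (S : nat -> sketch R m) (k : nat) : 'cV[R]_n :=
  if k is k'.+1 then sgd_step (S k') (sgd x0 S k') else x0.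

End reformulation.

Definition minimizers (R : realType) (V : Type) (g : V -> \bar R) : set V :=
  [set x | forall y, (g x <= g y)%E].

Definition is_projection (R : realType) (n : nat) (L : set 'cV[R]_n)
    (x p : 'cV[R]_n) : Prop :=
  L p /\ forall y, L y -> enorm (x - p) <= enorm (x - y).

(* The infimum is over a finite set, hence attained whenever W has a nonzero
   eigenvalue. *)
Definition lambda_min_pos (R : realType) (n : nat) (W : 'M[R]_n) : R :=
  inf [set a | eigenvalue W a /\ a != 0].

Definition mutually_independent (R : realType) d d' (Omega : measurableType d)
    (T : measurableType d') (P : probability Omega R)
    (X : nat -> {RV P >-> T}) : Prop :=
  forall (J : seq nat) (B : nat -> set T),
    uniq J -> (forall j, measurable (B j)) ->
    P (\bigcap_(j in [set` J]) X j @^-1` B j) =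
      (\prod_(j <- J) P (X j @^-1` B j))%E.

Definition has_law (R : realType) d d' (Omega : measurableType d)
    (T : measurableType d') (P : probability Omega R) (D : probability T R)
    (X : {RV P >-> T}) : Prop :=
  forall B : set T, measurable B -> distribution P X B = D B.

(* Main.v *)
Require Import Defs.
From HB Require Import structures.
From mathcomp Require Import all_boot all_order all_algebra.
From mathcomp Require Import all_classical all_reals all_analysis.
From mathcomp Require Import measurable_realfun ring lra.

Set Implicit Arguments.
Unset Strict Implicit.
Unset Printing Implicit Defensive.

Import Order.TTheory GRing.Theory Num.Theory.
Import numFieldNormedType.Exports.

Local Open Scope classical_set_scope.
Local Open Scope ring_scope.

(** Let Z_S = A^T H_S A, let xs be a solution and e = x - xs. Since Z_S is the
    orthogonal projector onto the row space of S^T A, f_S(x) = |Z_S e|^2 / 2 has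
    infimum 0 and gradient Z_S e, so that the Polyak stepsize with c = 1/2 is
    equal to 1 whenever the gradient is nonzero. SGD is thus the random
    projection method e_(k+1) = (1 - Z_(S_k)) e_k ([sgd_error]).

    By Pythagoras |e_(k+1)|^2 = |e_k|^2 - e_k^T Z_(S_k) e_k, and as S_k is
    independent of e_k the expectation is E |e_k|^2 - E [e_k^T W e_k]
    ([expected_sgd_step]). It remains to bound e^T W e below by
    lambda_min^+(W) |e|^2 along the trajectory. As x* is the projection of x0,
    e_0 is orthogonal to ker A, and every Z_S e lies in the row space of A, so
    e_k stays in that row space. Exactness says that e^T W e = 0 forces A e = 0,
    hence W is positive definite on the row space; the minimum of the Rayleigh
    quotient over that space is then a positive eigenvalue of W
    ([lambda_min_pos_gap]).

    Two measure-theoretic points carry weight. The map from S to Z_S is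
    measurable although the pseudoinverse is discontinuous, because Z_S is the
    limit of 1 - (1 + k A^T S S^T A)^-1 ([sketch_proj_measurable]). And product
    rules for finitely many sketches upgrade, by a pi-system argument and
    Fubini, to the freezing of the past used above ([integral_past_fresh]). *)

(** * Squared norms and quadratic forms *)

Definition sqnorm (R : realType) (n : nat) (x : 'cV[R]_n) : R := (x^T *m x) 0 0.

Lemma sqnormE (R : realType) (n : nat) (x : 'cV[R]_n) :
  sqnorm x = \sum_(i < n) x i 0 ^+ 2.
Proof. by rewrite /sqnorm mxE; apply: eq_bigr => i _; rewrite mxE expr2. Qed.

Lemma enorm_sqr (R : realType) (n : nat) (x : 'cV[R]_n) :
  enorm x ^+ 2 = sqnorm x.
Proof. by rewrite sqnormE sqr_sqrtr// sumr_ge0// => i _; exact: sqr_ge0. Qed.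

Lemma sqnorm_ge0 (R : realType) (n : nat) (x : 'cV[R]_n) : 0 <= sqnorm x.
Proof. by rewrite -enorm_sqr sqr_ge0. Qed.

Lemma sqnorm_eq0 (R : realType) (n : nat) (x : 'cV[R]_n) :
  (sqnorm x == 0) = (x == 0).
Proof.
apply/eqP/eqP => [|->]; last by rewrite /sqnorm mulmx0 mxE.
rewrite sqnormE => /eqP; rewrite psumr_eq0 => [/allP x0|i _]; last exact: sqr_ge0.
apply/matrixP => i j; rewrite ord1 [RHS]mxE; apply/eqP.
by rewrite -sqrf_eq0; apply: x0; rewrite mem_index_enum.
Qed.

Lemma coord_sqr_le_sqnorm (R : realType) (n : nat) (x : 'cV[R]_n) (i : 'I_n) :
  x i 0 ^+ 2 <= sqnorm x.
Proof.
by rewrite sqnormE (bigD1 i)//= lerDl sumr_ge0// => j _; exact: sqr_ge0.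
Qed.

Lemma dotmxC (R : realType) (n : nat) (x y : 'cV[R]_n) :
  (x^T *m y) 0 0 = (y^T *m x) 0 0.
Proof. by rewrite !mxE; apply: eq_bigr => i _; rewrite !mxE mulrC. Qed.

Lemma sqnormD (R : realType) (n : nat) (x y : 'cV[R]_n) :
  sqnorm (x + y) = sqnorm x + 2 * (x^T *m y) 0 0 + sqnorm y.
Proof.
have E : sqnorm (x + y) =
    (x^T *m x) 0 0 + (x^T *m y) 0 0 + ((y^T *m x) 0 0 + (y^T *m y) 0 0).
  rewrite /sqnorm [(x + y)^T]linearD/= mulmxDl !mulmxDr.
  by rewrite [LHS]mxE; congr (_ + _); rewrite [LHS]mxE.
by rewrite E (dotmxC y x) /sqnorm; ring.
Qed.

Lemma sqnormZ (R : realType) (n : nat) (a : R) (x : 'cV[R]_n) :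
  sqnorm (a *: x) = a ^+ 2 * sqnorm x.
Proof.
by rewrite /sqnorm [(a *: x)^T]linearZ/= -scalemxAl -scalemxAr scalerA -expr2 mxE.
Qed.

Lemma sqnormB (R : realType) (n : nat) (x y : 'cV[R]_n) :
  sqnorm (x - y) = sqnorm x - 2 * (x^T *m y) 0 0 + sqnorm y.
Proof.
rewrite sqnormD -scaleN1r sqnormZ -scalemxAr.
have -> : (-1 *: (x^T *m y)) 0 0 = - (x^T *m y) 0 0 by rewrite mxE mulN1r.
by ring.
Qed.

(** Row by row, since the diagonal of N N^T carries the squared norms of the rows. *)
Lemma mulmx_tr_eq0 (R : realType) (m n : nat) (N : 'M[R]_(m, n)) :
  N *m N^T = 0 -> N = 0.
Proof.
move=> NN0; apply/row_matrixP => i; rewrite row0; apply/eqP.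
rewrite -trmx_eq0 -sqnorm_eq0 /sqnorm trmxK tr_row mxE.
have /matrixP/(_ i i) := NN0; rewrite !mxE => NN0i.
by apply/eqP; rewrite -[RHS]NN0i; apply: eq_bigr => j _; rewrite !mxE.
Qed.

Definition quad (R : realType) (n : nat) (W : 'M[R]_n) (x : 'cV[R]_n) : R :=
  (x^T *m W *m x) 0 0.

Lemma quadD (R : realType) (n : nat) (W : 'M[R]_n) (x y : 'cV[R]_n) :
  W^T = W -> quad W (x + y) = quad W x + 2 * (y^T *m W *m x) 0 0 + quad W y.
Proof.
move=> WT.
have WC : (x^T *m W *m y) 0 0 = (y^T *m W *m x) 0 0.
  by rewrite -mulmxA dotmxC trmx_mul WT.
rewrite -WC /quad [(x + y)^T]linearD/= !mulmxDl !mulmxDr [LHS]mxE.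
rewrite [X in X + _ = _]mxE [X in _ + X = _]mxE -WC; ring.
Qed.

Lemma quadZ (R : realType) (n : nat) (W : 'M[R]_n) (a : R) (x : 'cV[R]_n) :
  quad W (a *: x) = a ^+ 2 * quad W x.
Proof.
rewrite /quad [(a *: x)^T]linearZ/= -!scalemxAl -scalemxAr scalerA -expr2.
by rewrite mxE.
Qed.

Lemma quad1 (R : realType) (n : nat) (x : 'cV[R]_n) : quad 1%:M x = sqnorm x.
Proof. by rewrite /quad mulmx1. Qed.

Lemma quad_gram (R : realType) (m n : nat) (B : 'M[R]_(m, n)) (x : 'cV[R]_n) :
  quad (B^T *m B) x = sqnorm (B *m x).
Proof. by rewrite /quad /sqnorm trmx_mul !mulmxA. Qed.

(** * The sketched projector *)

(** The transpose of a pseudoinverse is a pseudoinverse of the transpose, and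
    pseudoinverses are unique. *)
Lemma mp_pinv_sym (R : realType) (n : nat) (G : 'M[R]_n) :
  G^T = G -> (mp_pinv G)^T = mp_pinv G.
Proof.
move=> GT; move: (mp_pinv G) (mp_pinvP G) => X XP.
have [GXG XGX GX XG] := XP.
apply: (is_pinv_unique _ XP); split.
- by rewrite -{1 2}GT -!trmx_mul mulmxA GXG.
- by rewrite -{1}GT -!trmx_mul mulmxA XGX.
- by rewrite -{1}GT -trmx_mul XG -{2}GT -trmx_mul XG.
- by rewrite -{1}GT -trmx_mul GX -{2}GT -trmx_mul GX.
Qed.

Section sketched_projector.
Context (R : realType) (m n : nat) (A : 'M[R]_(m, n)).

(** The Gram matrix N^T N of the sketched system N = S^T A. Its size does not
    depend on the number of columns of S, and it is continuous in S. *)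
Definition sketch_gram (S : sketch R m) : 'M[R]_n :=
  A^T *m projT2 S *m (projT2 S)^T *m A.

(** With N = S^T A this is N^T (N N^T)^+ N, the orthogonal projector onto the
    row space of N. *)
Definition sketch_proj (S : sketch R m) : 'M[R]_n := A^T *m Hmx A S *m A.

(** With N = S^T A, G = N N^T and X the pseudoinverse of G, everything follows
    from G X N = N and from G X = X G. The two clauses on the Gram matrix say
    that the projector and the Gram matrix have the same column space; they are
    what the regularization argument for measurability uses. *)
Lemma sketch_projP (S : sketch R m) :
  [/\ (sketch_proj S)^T = sketch_proj S,
      sketch_proj S *m sketch_proj S = sketch_proj S,
      sketch_gram S *m sketch_proj S = sketch_gram S
    & exists Q, sketch_proj S = sketch_gram S *m Q].
Proof.
case: S => q M; rewrite /sketch_proj /sketch_gram /Hmx /=.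
set N := M^T *m A; pose G := N *m N^T.
have NT : A^T *m M = N^T by rewrite /N trmx_mul trmxK.
have GE : N *m A^T *m M = G by rewrite -mulmxA NT.
have KE : A^T *m M *m M^T *m A = N^T *m N by rewrite NT -mulmxA.
have ZE X : A^T *m (M *m X *m M^T) *m A = N^T *m X *m N.
  by rewrite !mulmxA NT -!mulmxA.
rewrite KE GE ZE; clearbody N; clear NT GE KE ZE.
have GT : G^T = G by rewrite /G trmx_mul trmxK.
set X := mp_pinv G.
have [GXG XGX GX XG] : is_pinv G X := mp_pinvP G.
have XT : X^T = X by exact: mp_pinv_sym.
have GXC : G *m X = X *m G by rewrite -GX trmx_mul XT GT.
(* (G X - 1) N annihilates its own transpose, since (G X - 1) G = 0. *)
have GXN : G *m X *m N = N.
  apply/eqP; rewrite -subr_eq0; apply/eqP/mulmx_tr_eq0.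
  have -> : G *m X *m N - N = (G *m X - 1%:M) *m N by rewrite mulmxBl mul1mx.
  rewrite trmx_mul mulmxA -(mulmxA _ N) -/G.
  by rewrite mulmxBl mul1mx GXG subrr mul0mx.
split.
- by rewrite !trmx_mul trmxK XT -mulmxA.
- by rewrite -mulmxA !(mulmxA N) -/G GXN.
- by rewrite -mulmxA !(mulmxA N) -/G GXN.
- (* N^T X N = N^T (X G X) N = N^T G X X N, and N^T G = (N^T N) N^T. *)
  exists (N^T *m X *m X *m N).
  rewrite -[RHS]mulmxA !(mulmxA N) -/G.
  by rewrite GXC XGX mulmxA.
Qed.

Lemma sketch_proj_sym S : (sketch_proj S)^T = sketch_proj S.
Proof. by case: (sketch_projP S). Qed.

Lemma sketch_proj_idem S : sketch_proj S *m sketch_proj S = sketch_proj S.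
Proof. by case: (sketch_projP S). Qed.

Lemma quad_sketch_proj S (x : 'cV[R]_n) :
  quad (sketch_proj S) x = sqnorm (sketch_proj S *m x).
Proof.
rewrite /quad /sqnorm trmx_mul sketch_proj_sym mulmxA -[in RHS](mulmxA x^T).
by rewrite sketch_proj_idem.
Qed.

(** Pythagoras for an orthogonal projector. *)
Lemma sqnorm_sub_sketch_proj S (x : 'cV[R]_n) :
  sqnorm (x - sketch_proj S *m x) = sqnorm x - quad (sketch_proj S) x.
Proof. by rewrite sqnormB mulmxA -quad_sketch_proj /quad; ring. Qed.

Lemma quad_sketch_proj_ge0 S (x : 'cV[R]_n) :
  0 <= quad (sketch_proj S) x.
Proof. by rewrite quad_sketch_proj sqnorm_ge0. Qed.

Lemma quad_sketch_proj_le S (x : 'cV[R]_n) :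
  quad (sketch_proj S) x <= sqnorm x.
Proof. by rewrite -subr_ge0 -sqnorm_sub_sketch_proj sqnorm_ge0. Qed.

Lemma sketch_proj_coord_le1 S i j : `|sketch_proj S i j| <= 1.
Proof.
have e1 : sqnorm (delta_mx j 0 : 'cV[R]_n) = 1.
  rewrite sqnormE (bigD1 j)//= mxE !eqxx expr1n big1 ?addr0// => l /negbTE lj.
  by rewrite mxE lj expr0n.
have := coord_sqr_le_sqnorm (sketch_proj S *m (delta_mx j 0 : 'cV_n)) i.
rewrite -quad_sketch_proj => /le_trans/(_ (quad_sketch_proj_le _ _)).
by rewrite e1 -colE mxE -real_normK ?num_real// expr_le1.
Qed.

End sketched_projector.

(** * SGD with Polyak stepsizes as random projections *)

Section sketched_objective.
Context (R : realType) (m n : nat) (A : 'M[R]_(m, n)) (b : 'cV[R]_m).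
Context (xs : 'cV[R]_n) (Axs : A *m xs = b).

Lemma fS_quad S x :
  fS A b S x = 2^-1 * quad (sketch_proj A S) (x - xs).
Proof.
rewrite /fS -Axs -mulmxBr trmx_mul /quad /sketch_proj.
by congr (_ * _); rewrite !mulmxA.
Qed.

Lemma fS_sqnorm S x :
  fS A b S x = 2^-1 * sqnorm (sketch_proj A S *m (x - xs)).
Proof. by rewrite fS_quad quad_sketch_proj. Qed.

Lemma fS_inf_eq0 S : fS_inf A b S = 0.
Proof.
have f0 y : range (fS A b S) y -> 0 <= y.
  by move=> [x _ <-]; rewrite fS_sqnorm mulr_ge0 ?invr_ge0// sqnorm_ge0.
apply/eqP; rewrite eq_le; apply/andP; split.
- apply: ge_inf; first by exists 0.
  by exists xs => //; rewrite fS_sqnorm subrr mulmx0 /sqnorm mulmx0 mxE mulr0.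
- by apply: lb_le_inf => //; exists (fS A b S xs), xs.
Qed.

(** The difference quotient along v is affine in the step h, with constant term
    (Z e)^T (Z v), which is (Z e)^T v because Z is a symmetric idempotent. *)
Lemma gradient_fS S x : gradient (fS A b S) x = sketch_proj A S *m (x - xs).
Proof.
set Z := sketch_proj A S; set u := Z *m (x - xs).
apply/matrixP => i j; rewrite ord1 /gradient mxE; set v := delta_mx i 0.
have uv : (u^T *m (Z *m v)) 0 0 = u i 0.
  rewrite mulmxA -[u^T *m Z]trmxK trmx_mul trmxK sketch_proj_sym.
  by rewrite /u mulmxA sketch_proj_idem -colE !mxE.
rewrite /derive; apply: cvg_lim => //.
have quotE : {near 0^', (fun h : R => u i 0 + h * (2^-1 * sqnorm (Z *m v))) =1
    (fun h : R => h^-1 *: (fS A b S (h *: v + x) - fS A b S x))}.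
  near=> h; rewrite !fS_sqnorm -addrA addrC -/Z -/u.
  have h0 : h != 0 by near: h; exact: nbhs_dnbhs_neq.
  rewrite mulmxDr -/u -scalemxAr sqnormD sqnormZ -scalemxAr.
  have -> : (h *: (u^T *m (Z *m v))) 0 0 = h * u i 0 by rewrite mxE uv.
  by rewrite /GRing.scale/=; field.
apply: cvg_trans; first exact: near_eq_cvg quotE.
have : u i 0 + h * (2^-1 * sqnorm (Z *m v)) @[h --> 0^'] -->
    u i 0 + 0 * (2^-1 * sqnorm (Z *m v)).
  apply: cvgD; first exact: cvg_cst.
  by apply: cvgM; [exact: cvg_within|exact: cvg_cst].
by rewrite mul0r addr0.
Unshelve. all: by end_near. Qed.

(** The gradient is g = Z e with e = x - xs, and f_S(x) - inf f_S = |g|^2 / 2, so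
    the stepsize with c = 1/2 is exactly 1 unless g = 0; in that case both
    sides are x. *)
Lemma sgd_stepE S x : sgd_step A b S x = x - sketch_proj A S *m (x - xs).
Proof.
rewrite /sgd_step gradient_fS; case: eqP => [->|/eqP u0]; first by rewrite subr0.
rewrite /sps_stepsize fS_inf_eq0 subr0 gradient_fS enorm_sqr fS_sqnorm.
by rewrite mulrA divff// mul1r divff ?sqnorm_eq0// scale1r.
Qed.

Lemma sgd_error x0 S k :
  sgd A b x0 S k.+1 - xs =
  (sgd A b x0 S k - xs) - sketch_proj A (S k) *m (sgd A b x0 S k - xs).
Proof. by rewrite /= sgd_stepE addrAC. Qed.

End sketched_objective.

(** * Rayleigh quotients and the smallest nonzero eigenvalue *)

Lemma continuous_sumr (R : realType) (T : topologicalType) (I : Type)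
    (r : seq I) (f : I -> T -> R) :
  (forall i, continuous (f i)) -> continuous (fun x => \sum_(i <- r) f i x).
Proof.
move=> cf; elim: r => [|i r IHr].
  under eq_fun do rewrite big_nil.
  by move=> x; exact: cvg_cst.
under eq_fun do rewrite big_cons.
by move=> x; apply: cvgD; [exact: cf|exact: IHr].
Qed.

Lemma quad_continuous (R : realType) (n : nat) (W : 'M[R]_n) :
  continuous (fun v : 'rV[R]_n => quad W v^T).
Proof.
have -> : (fun v : 'rV[R]_n => quad W v^T) =
    (fun v => \sum_i (\sum_j v 0 j * W j i) * v 0 i).
  apply/funext => v; rewrite /quad trmxK mxE; apply: eq_bigr => i _.
  by rewrite !mxE.
apply: continuous_sumr => i v.
have vW : continuous (fun v : 'rV[R]_n => \sum_j v 0 j * W j i).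
  apply: continuous_sumr => j w.
  exact: (@continuousM _ _ _ (cst (W j i)) w (@coord_continuous _ _ _ _ _ w)
    (@cst_continuous _ _ (W j i) w)).
by apply: (@continuousM _ _ _ _ v (vW v)); exact: coord_continuous.
Qed.

(** Compactness of the unit sphere of ker B; homogeneity extends the bound from
    the sphere to all of ker B. *)
Lemma rayleigh_attained (R : realType) (p n : nat) (W : 'M[R]_n)
    (B : 'M[R]_(p, n)) :
  (exists2 x : 'cV[R]_n, x != 0 & B *m x = 0) ->
  exists2 x : 'cV[R]_n, sqnorm x = 1 /\ B *m x = 0 &
    forall y, B *m y = 0 -> quad W x * sqnorm y <= quad W y.
Proof.
move=> [x0 x0n0 Bx0].
pose U := [set v : 'rV[R]_n | sqnorm v^T = 1 /\ B *m v^T = 0].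
have normalize (x : 'cV[R]_n) : x != 0 -> B *m x = 0 -> U ((enorm x)^-1 *: x)^T.
  move=> xn0 Bx; rewrite /U/= trmxK sqnormZ exprVn enorm_sqr mulVf ?sqnorm_eq0//.
  by rewrite -scalemxAr Bx scaler0.
(* U is bounded, and closed as the intersection of the level sets of the two
   quadratic forms |v|^2 and |B v|^2. *)
have Ucpt : compact U.
  apply: bounded_closed_compact.
    exists 1; split; first exact: num_real.
    move=> M M1 v [v1 _]/=; rewrite (le_trans _ (ltW M1))//.
    rewrite /Num.norm/= mx_normrE; apply/bigmax_leP; split => //= -[i j] _ /=.
    have := coord_sqr_le_sqnorm v^T j.
    by rewrite v1 mxE ord1 -real_normK ?num_real// expr_le1.
  have -> : U = (fun v : 'rV[R]_n => quad 1%:M v^T) @^-1` [set z | z = 1] `&`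
      (fun v : 'rV[R]_n => quad (B^T *m B) v^T) @^-1` [set z | z = 0].
    apply/seteqP; split => v; rewrite /U/= quad1 quad_gram.
      by move=> [-> ->]; split => //; apply/eqP; rewrite sqnorm_eq0.
    by move=> [-> /eqP]; rewrite sqnorm_eq0 => /eqP.
  by apply: closedI; apply: preimage_closed (@closed_eq _ _) => v _;
    exact: quad_continuous.
have U0 : U !=set0 by exists ((enorm x0)^-1 *: x0)^T; exact: normalize.
have Wcont : {within U, continuous (fun v => quad W v^T)}.
  by apply: continuous_subspaceT; exact: quad_continuous.
have [v /set_mem [v1 Bv] vmin] := EVT_min_rV U0 Ucpt Wcont.
exists v^T => // y By; have [->|yn0] := eqVneq y 0.
  have -> : sqnorm (0 : 'cV[R]_n) = 0 by apply/eqP; rewrite sqnorm_eq0.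
  by rewrite mulr0 /quad mulmx0 mxE.
have := vmin _ (mem_set (normalize _ yn0 By)).
rewrite trmxK quadZ exprVn enorm_sqr mulrC ler_pdivlMr//.
by rewrite lt_neqAle eq_sym sqnorm_eq0 yn0 sqnorm_ge0.
Qed.

(** First-order condition at the minimum: u = W x - mu x lies in ker B, and
    moving from x along t u changes the Rayleigh defect by 2 t |u|^2 + O(t^2),
    which must stay nonnegative for every t, so u = 0. *)
Lemma rayleigh_eigenvalue (R : realType) (p n : nat) (W : 'M[R]_n)
    (B : 'M[R]_(p, n)) (x : 'cV[R]_n) :
  W^T = W -> (forall y : 'cV[R]_n, B *m y = 0 -> B *m (W *m y) = 0) ->
  sqnorm x = 1 -> B *m x = 0 ->
  (forall y, B *m y = 0 -> quad W x * sqnorm y <= quad W y) ->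
  eigenvalue W (quad W x).
Proof.
move=> WT WB x1 Bx xmin; set mu := quad W x.
pose u := W *m x - mu *: x.
have Bu : B *m u = 0 by rewrite mulmxBr WB// -scalemxAr Bx scaler0 subrr.
have uWx : (u^T *m W *m x) 0 0 = sqnorm u + mu * (x^T *m u) 0 0.
  have -> : u^T *m W *m x = u^T *m u + mu *: (u^T *m x).
    have uE : W *m x = u + mu *: x by rewrite subrK.
    by rewrite -mulmxA uE mulmxDr -scalemxAr.
  by rewrite dotmxC [LHS]mxE; congr (_ + _); rewrite mxE.
have descent t : 0 <= 2 * t * sqnorm u + t ^+ 2 * (quad W u - mu * sqnorm u).
  have := xmin (x + t *: u); rewrite mulmxDr Bx -scalemxAr Bu scaler0 addr0.
  move=> /(_ erefl); rewrite sqnormD x1 quadD// -/mu quadZ sqnormZ.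
  have -> : (x^T *m (t *: u)) 0 0 = t * (x^T *m u) 0 0 by rewrite -scalemxAr mxE.
  have -> : ((t *: u)^T *m W *m x) 0 0 = t * (u^T *m W *m x) 0 0.
    by rewrite [(t *: u)^T]linearZ/= -!scalemxAl mxE.
  by rewrite uWx -subr_ge0; congr (0 <= _); ring.
have u0 : sqnorm u = 0.
  apply/eqP; rewrite eq_le sqnorm_ge0 andbT leNgt; apply/negP => u_gt0.
  set c := quad W u - mu * sqnorm u in descent.
  have c_ge0 : 0 <= c by rewrite subr_ge0 xmin.
  (* The exact minimizer is t = - |u|^2 / c; c + 1 avoids dividing by zero. *)
  have := descent (- (sqnorm u / (c + 1))).
  have c1 : 0 < c + 1 by lra.
  set s := sqnorm u in u_gt0 *; set r := s / (c + 1).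
  have rE : s = r * (c + 1) by rewrite /r divfK// gt_eqF.
  have r0 : 0 < r by rewrite divr_gt0.
  rewrite {1}rE; nra.
apply/eigenvalueP; exists x^T; last by rewrite trmx_eq0 -sqnorm_eq0 x1 oner_eq0.
apply: trmx_inj; rewrite trmx_mul trmxK WT linearZ/= trmxK.
by apply/eqP; rewrite -subr_eq0 -/u -sqnorm_eq0 u0.
Qed.

(** Positivity of W bounds the eigenvalues below by 0, so that the infimum is a
    lower bound. *)
Lemma lambda_min_pos_le (R : realType) (n : nat) (W : 'M[R]_n) (a : R) :
  W^T = W -> (forall x, 0 <= quad W x) -> eigenvalue W a -> a != 0 ->
  lambda_min_pos W <= a.
Proof.
move=> WT W0 Wa a0; apply: ge_inf => //; exists 0 => c [/eigenvalueP [v vW v0] _].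
have : 0 <= c * sqnorm v^T.
  have := W0 v^T; rewrite /quad trmxK vW -scalemxAl.
  by rewrite mxE /sqnorm trmxK.
by rewrite pmulr_lge0// lt_neqAle eq_sym sqnorm_eq0 trmx_eq0 v0 sqnorm_ge0.
Qed.

(** * Measurability of the sketched projector *)

(** Writing 1/x as x (x^2)^(-1) reduces to powers with nonnegative base, and is
    also correct at 0, where the inverse is 0. *)
Lemma measurable_invr (R : realType) :
  measurable_fun [set: R] (fun x : R => x^-1).
Proof.
have -> : (fun x : R => x^-1) = (fun x => x * (x ^+ 2) `^ (-1)).
  apply/funext => x; rewrite powR_inv1 ?sqr_ge0//.
  by have [->|x0] := eqVneq x 0; [rewrite invr0 mul0r|field].
apply: measurable_funM => //.
have mX : measurable_fun [set: R] (fun x : R => x ^+ 2) by exact: measurable_funX.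
exact: (measurableT_comp (measurable_powR (-1)) mX).
Qed.

Section measurable_matrices.
Context (R : realType) d (T : measurableType d).

Definition mx_measurable (m n : nat) (F : T -> 'M[R]_(m, n)) :=
  forall i j, measurable_fun [set: T] (fun t => F t i j).

Lemma mx_measurableM (m n p : nat) (F : T -> 'M[R]_(m, n)) (G : T -> 'M[R]_(n, p)) :
  mx_measurable F -> mx_measurable G -> mx_measurable (fun t => F t *m G t).
Proof.
move=> mF mG i j; under eq_fun do rewrite mxE.
by apply: measurable_sum => l; exact: measurable_funM.
Qed.

Lemma mx_measurableB (m n : nat) (F G : T -> 'M[R]_(m, n)) :
  mx_measurable F -> mx_measurable G -> mx_measurable (fun t => F t - G t).
Proof.
move=> mF mG i j; under eq_fun do rewrite !mxE.
exact: measurable_funB.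
Qed.

Lemma measurable_sqnorm (n : nat) (F : T -> 'cV[R]_n) :
  mx_measurable F -> measurable_fun [set: T] (fun t => sqnorm (F t)).
Proof.
move=> mF; under eq_fun do rewrite sqnormE.
by apply: measurable_sum => i; apply: measurable_funX.
Qed.

Lemma measurable_quad (n : nat) (W : 'M[R]_n) (F : T -> 'cV[R]_n) :
  mx_measurable F -> measurable_fun [set: T] (fun t => quad W (F t)).
Proof.
move=> mF; pose FT t := (F t)^T.
have mFT : mx_measurable FT.
  by move=> i j; rewrite /FT; under eq_fun do rewrite mxE; exact: mF.
have mW : mx_measurable (fun=> W) by move=> i j; exact: measurable_cst.
exact: (mx_measurableM (mx_measurableM mFT mW) mF 0 0).
Qed.

Lemma measurable_det (n : nat) (F : T -> 'M[R]_n) :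
  mx_measurable F -> measurable_fun [set: T] (fun t => \det (F t)).
Proof.
move=> mF; apply: measurable_sum => s; apply: measurable_funM => //.
by apply: measurable_prod => i _; exact: mF.
Qed.

(** Cramer's rule: the entries of the inverse are quotients of polynomials in the
    entries. *)
Lemma mx_measurable_inv (n : nat) (F : T -> 'M[R]_n) :
  (forall t, F t \in unitmx) -> mx_measurable F ->
  mx_measurable (fun t => invmx (F t)).
Proof.
move=> uF mF i j; under eq_fun => t do rewrite /invmx uF !mxE /cofactor.
apply: measurable_funM.
  exact: (measurableT_comp (@measurable_invr R) (measurable_det mF)).
apply: measurable_funM => //; apply: measurable_det => k l.
under eq_fun do rewrite !mxE; exact: mF.
Qed.

End measurable_matrices.

Section regularized_inverse.
Context (R : realType) (n : nat) (K : 'M[R]_n).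
Hypothesis K_ge0 : forall x, 0 <= quad K x.

Lemma quad_add1_ge (k : nat) (x : 'cV[R]_n) :
  sqnorm x <= quad (1%:M + k%:R *: K) x.
Proof.
rewrite /quad mulmxDr mulmx1 mulmxDl -scalemxAr -scalemxAl.
have -> : (x^T *m x + k%:R *: (x^T *m K *m x)) 0 0 = sqnorm x + k%:R * quad K x.
  by rewrite mxE; congr (_ + _); rewrite mxE.
by rewrite lerDl mulr_ge0.
Qed.

Lemma add1_unit (k : nat) : 1%:M + k%:R *: K \in unitmx.
Proof.
rewrite -unitmx_tr -row_free_unit; apply: inj_row_free => v v0.
have : sqnorm v^T <= 0.
  rewrite (le_trans (quad_add1_ge k _))// /quad -mulmxA.
  by rewrite -[X in _ *m X]trmxK trmx_mul trmxK v0 trmx0 mulmx0 mxE.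
by rewrite le_eqVlt ltNge sqnorm_ge0 orbF sqnorm_eq0 trmx_eq0 => /eqP.
Qed.

(** If (1 + k K) y = x then |y|^2 <= y^T x, hence |y| <= |x|: the resolvents of a
    positive K are contractions. *)
Lemma sqnorm_inv_add1_le (k : nat) (x : 'cV[R]_n) :
  sqnorm (invmx (1%:M + k%:R *: K) *m x) <= sqnorm x.
Proof.
set y := invmx _ *m x.
have yx : (1%:M + k%:R *: K) *m y = x by rewrite mulKVmx// add1_unit.
have := quad_add1_ge k y; rewrite /quad -mulmxA yx => yx_le.
have := sqnorm_ge0 (y - x); rewrite sqnormB.
lra.
Qed.

(** Tikhonov regularization. The resolvent V = (1 + k K)^-1 fixes 1 - Z, because
    K (1 - Z) = 0, while V Z = V K Q = (1/k) (Q - V Q) tends to 0, because V is a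
    contraction. *)
Lemma inv_add1_cvg (Z Q : 'M[R]_n) (i j : 'I_n) : K *m Z = K -> Z = K *m Q ->
  (1%:M - invmx (1%:M + k.+1%:R *: K)) i j @[k --> \oo] --> Z i j.
Proof.
move=> KZ ZQ; pose V k := invmx (1%:M + k.+1%:R *: K).
have VE k : 1%:M - V k = Z - k.+1%:R^-1 *: (Q - V k *m Q).
  have Vl : V k *m (1%:M + k.+1%:R *: K) = 1%:M by rewrite mulVmx// add1_unit.
  have VP : V k *m (1%:M - Z) = 1%:M - Z.
    have fixZ : (1%:M + k.+1%:R *: K) *m (1%:M - Z) = 1%:M - Z.
      by rewrite mulmxDl mul1mx -scalemxAl mulmxBr mulmx1 KZ subrr scaler0 addr0.
    by rewrite -{1}fixZ mulmxA Vl mul1mx.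
  have VZ : V k *m Z = k.+1%:R^-1 *: (Q - V k *m Q).
    have -> : Q - V k *m Q = V k *m (k.+1%:R *: K) *m Q.
      have <- : 1%:M - V k = V k *m (k.+1%:R *: K).
        by rewrite -[in LHS]Vl mulmxDr mulmx1 addrC addKr.
      by rewrite mulmxBl mul1mx.
    by rewrite -scalemxAr -scalemxAl scalerA mulVf ?pnatr_eq0// scale1r -mulmxA -ZQ.
  move: VP; rewrite -VZ mulmxBr mulmx1 => /eqP.
  rewrite subr_eq => /eqP {1}->.
  by rewrite opprD opprB addrA [1%:M + _]addrC subrK.
pose c := Num.sqrt (sqnorm (col j Q)).
have VQ_le k : `|(V k *m Q) i j| <= c.
  have := coord_sqr_le_sqnorm (V k *m col j Q) i.
  move=> /le_trans/(_ (sqnorm_inv_add1_le _ _)).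
  have -> : (V k *m col j Q) i 0 = (V k *m Q) i j 
    by rewrite !mxE; apply: eq_bigr => l _; rewrite mxE.
  by move=> VQ2; rewrite -sqrtr_sqr ler_wsqrtr.
have harm0 : k.+1%:R^-1 * (`|Q i j| + c) @[k --> \oo] --> (0 : R).
  rewrite -[X in _ --> X](mul0r (`|Q i j| + c)); apply: cvgM.
    exact: cvg_harmonic.
  exact: cvg_cst.
apply/subr_cvg0; apply/norm_cvg0P.
apply: (squeeze_cvgr _ (cvg_cst 0) harm0); apply: nearW => k.
rewrite normr_ge0/= -/(V k) VE !mxE addrAC subrr add0r normrN normrM.
rewrite ger0_norm ?invr_ge0// ler_wpM2l ?invr_ge0//.
by rewrite (le_trans (ler_normB _ _))// lerD2l; have := VQ_le k; rewrite mxE.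
Qed.

End regularized_inverse.

Section sketch_measurability.
Context (R : realType) (m : nat).

(** The sigma-algebra of the sketch space is generated by the open sets. *)
Lemma continuous_sketch_measurable (f : sketch R m -> R) :
  continuous f -> measurable_fun [set: sketch_space R m] f.
Proof.
move=> /continuousP cf; apply: (measurability _ (RGenOpens.measurableE R)) => //.
move=> _ [_ [x [y ->]] <-]; rewrite setTI; apply: sub_sigma_algebra.
by apply: cf; exact: itv_open.
Qed.

Lemma sketch_gram_measurable (n : nat) (A : 'M[R]_(m, n)) :
  mx_measurable (fun S : sketch_space R m => sketch_gram A S).
Proof.
move=> i j; apply: continuous_sketch_measurable.
have cAM q (l : 'I_q) (k : 'I_n) :
    continuous (fun M : 'M[R]_(m, q) => \sum_a A a k * M a l).
  apply: continuous_sumr => a M.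
  exact: (@continuousM _ _ (cst (A a k)) _ M (@cst_continuous _ _ (A a k) M)
    (@coord_continuous _ _ _ a l M)).
pose g q (M : 'M[R]_(m, q)) :=
  \sum_l (\sum_a A a i * M a l) * (\sum_a A a j * M a l).
have -> : (fun S => sketch_gram A S i j) = (fun S => g (projT1 S) (projT2 S)).
  apply/funext => -[q M]; rewrite /sketch_gram/= -mulmxA mxE.
  apply: eq_bigr => l _; rewrite !mxE.
  by congr (_ * _); apply: eq_bigr => a _; rewrite !mxE// mulrC.
apply: (@sigT_continuous _ _ _ g) => q; apply: continuous_sumr => l M.
exact: (@continuousM _ _ _ _ M (cAM q l i M) (cAM q l j M)).
Qed.

Lemma quad_sketch_gram_ge0 (n : nat) (A : 'M[R]_(m, n)) (S : sketch R m) x :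
  0 <= quad (sketch_gram A S) x.
Proof.
have -> : sketch_gram A S = ((projT2 S)^T *m A)^T *m ((projT2 S)^T *m A).
  by rewrite /sketch_gram trmx_mul trmxK mulmxA.
by rewrite quad_gram sqnorm_ge0.
Qed.

(** The pseudoinverse is not continuous, so the projector is obtained as the
    pointwise limit of regularized inverses of the Gram matrix, each of which is
    measurable. *)
Lemma sketch_proj_measurable (n : nat) (A : 'M[R]_(m, n)) :
  mx_measurable (fun S : sketch_space R m => sketch_proj A S).
Proof.
move=> i j.
pose V k (S : sketch_space R m) := 1%:M + k.+1%:R *: sketch_gram A S.
apply: (@measurable_fun_cvg _ _ _ _ (fun k S => (1%:M - invmx (V k S)) i j)).
  move=> k; apply: mx_measurableB => [a c|]; first exact: measurable_cst.
  apply: mx_measurable_inv => [S|a c].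
    by apply: add1_unit => x; exact: quad_sketch_gram_ge0.
  have -> : (fun S => V k S a c) =
      (fun S => (a == c)%:R + k.+1%:R * sketch_gram A S a c).
    by apply/funext => S; rewrite /V !mxE.
  apply: measurable_funD; first exact: measurable_cst.
  apply: measurable_funM; [exact: measurable_cst|exact: sketch_gram_measurable].
move=> S _; have [_ _ KZ [Q ZQ]] := sketch_projP A S.
by apply: inv_add1_cvg KZ ZQ => x; exact: quad_sketch_gram_ge0.
Qed.

End sketch_measurability.

(** * Independence of the past and the fresh sample *)

Section past.
Context (R : realType) d (Omega : measurableType d) d' (T : measurableType d').
Context (P : probability Omega R) (X : nat -> {RV P >-> T}).

(** Events that constrain each of X 0, ..., X (k - 1) separately; they generate
    the sigma-algebra of the past before time k and are closed under
    intersection. *)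
Definition past_cylinders (k : nat) : set (set Omega) :=
  [set C | exists2 B : nat -> set T, (forall j, measurable (B j)) &
    C = \bigcap_(j in `I_k) (X j @^-1` B j)].

Definition past (k : nat) := g_sigma_algebraType (past_cylinders k).

Lemma past_cylinders_measurable k : past_cylinders k `<=` measurable.
Proof.
move=> _ [B mB ->]; apply: bigcap_measurableType => j _.
by rewrite -[X in measurable X]setTI; exact: measurable_funP.
Qed.

Lemma past_cylinders_setT k : past_cylinders k setT.
Proof.
by exists (fun=> setT) => [//|]; rewrite bigcapT.
Qed.

Lemma past_cylinders_setI k : setI_closed (past_cylinders k).
Proof.
move=> _ _ [B mB ->] [C mC ->]; exists (fun j => B j `&` C j).
  by move=> j; exact: measurableI.
by rewrite -bigcapI.
Qed.

Lemma past_measurable_fun k j : (j < k)%N ->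
  measurable_fun [set: past k] (X j).
Proof.
move=> jk _ B mB; rewrite setTI; apply: sub_sigma_algebra.
exists (fun i => if i == j then B else setT) => [i|]; first by case: ifP.
apply/seteqP; split => [w XB i _|w /(_ j jk)]; last by rewrite /= eqxx.
by rewrite /=; case: eqP => [->|].
Qed.

Lemma past_measurable_funS e (U : measurableType e) k (f : Omega -> U) :
  measurable_fun [set: past k] f -> measurable_fun [set: past k.+1] f.
Proof.
move=> mf _ B mB; have := mf measurableT _ mB.
apply: smallest_sub; first exact: smallest_sigma_algebra.
move=> _ [F mF ->]; apply: sub_sigma_algebra.
exists (fun j => if (j < k)%N then F j else setT).
  by move=> j; case: ifP.
apply/seteqP; split => w /= h j jk.
  by case: ifPn => // jk'; exact: h.
by have := h j (leqW jk); rewrite jk.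
Qed.

Lemma past_measurable_id k :
  measurable_fun [set: Omega] (id : Omega -> past k).
Proof.
move=> _ B; rewrite setTI preimage_id; apply: smallest_sub => //.
  exact: sigma_algebra_measurable.
exact: past_cylinders_measurable.
Qed.

Hypothesis X_indep : mutually_independent X.

(** Mutual independence for the index sets {0..k-1} and {0..k}. *)
Lemma past_cylinder_indep k C B : past_cylinders k C -> measurable B ->
  (P (C `&` X k @^-1` B) = P C * P (X k @^-1` B))%E.
Proof.
move=> [F mF CE] mB.
have iotaE l : [set` iota 0 l] = `I_l.
  by apply/seteqP; split => j /=; rewrite mem_iota.
pose F' j := if (j < k)%N then F j else B.
have mF' j : measurable (F' j) by rewrite /F'; case: ifP.
have F'k : F' k = B by rewrite /F' ltnn.
have PC := X_indep (iota_uniq 0 k) mF.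
have PCB := X_indep (iota_uniq 0 k.+1) mF'.
rewrite iotaE -CE in PC.
rewrite iotaE -addn1 iotaD big_cat big_seq1 add0n F'k in PCB.
rewrite PC; transitivity (P (\bigcap_(j in `I_k.+1) X j @^-1` F' j)).
  congr (P _); rewrite CE; apply/seteqP; split => w /=.
    move=> [Fw Bw] j /=; rewrite ltnS leq_eqVlt => /predU1P[->|jk].
      by rewrite /F' ltnn.
    by rewrite /F' jk; exact: Fw.
  move=> Fw; split => [j jk|]; first by have := Fw j (leqW jk); rewrite /F' /= jk.
  by have := Fw k (ltnSn k); rewrite /F' /= ltnn.
rewrite -addn1 PCB; congr (_ * _)%E; rewrite big_seq [in RHS]big_seq.
apply: eq_bigr => j; rewrite mem_iota add0n => /andP[_ jk].
by rewrite /F' jk.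
Qed.

(** Both sides are finite measures in C that agree on the generating pi-system. *)
Lemma past_indep k C B : measurable (C : set (past k)) -> measurable B ->
  (P (C `&` X k @^-1` B) = P C * P (X k @^-1` B))%E.
Proof.
move=> mC mB; have mXB : measurable (X k @^-1` B).
  by rewrite -[X in measurable X]setTI; exact: measurable_funP.
have PXB : P (X k @^-1` B) \is a fin_num by exact: fin_num_measure.
have r0 : (0 <= fine (P (X k @^-1` B)))%R by exact: fine_ge0.
pose m2 := mscale (NngNum r0) P.
have m2E A : m2 A = (P A * P (X k @^-1` B))%E.
  by rewrite /m2 /mscale/= fineK// muleC.
rewrite -m2E.
apply: (@g_sigma_algebra_measure_unique _ _ _ (past_cylinders k) _ (fun=> setT)
  _ _ (mrestr P mXB) m2) => //.
- exact: past_cylinders_measurable.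
- by move=> _; exact: past_cylinders_setT.
- by rewrite bigcup_const.
- exact: past_cylinders_setI.
- by move=> A cA; apply: eq_trans (esym (m2E A)); exact: past_cylinder_indep.
- by move=> _; rewrite ltey_eq fin_num_measure.
Qed.

(** Freezing lemma: the joint law of the past and of X k is a product measure, so
    that X k may be integrated out first with the past held fixed. *)
Lemma integral_past_fresh (D : probability T R) k (f : past k * T -> \bar R) :
  has_law D (X k) -> measurable_fun setT f -> (forall z, 0 <= f z)%E ->
  (\int[P]_w f (w, X k w) = \int[P]_w \int[D]_s f (w, s))%E.
Proof.
move=> Xlaw mf f0.
pose I : {mfun Omega >-> past k} := mfun_Sub (mem_set (@past_measurable_id k)).
have mJ : measurable_fun [set: Omega] (fun w => (w : past k, X k w)).
  by apply: measurable_fun_pair => //; exact: past_measurable_id.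
pose J : {mfun Omega >-> (past k * T)%type} := mfun_Sub (mem_set mJ).
have joint C : measurable C ->
    distribution P J C = (distribution P I \x D)%E C.
  move=> mC; apply/esym/product_measure_unique => // A B mA mB.
  rewrite /distribution /pushforward/=; rewrite -(Xlaw _ mB).
  exact: past_indep.
have -> : (\int[P]_w f (w, X k w) = \int[distribution P J]_z f z)%E.
  by rewrite ge0_integral_pushforward.
rewrite (eq_measure_integral (distribution P I \x D)%E); last first.
  by move=> C mC _; exact: joint.
rewrite fubini_tonelli1// ge0_integral_pushforward//.
  exact: measurable_fun_fubini_tonelli_F.
by move=> w _; exact: integral_ge0.
Qed.

End past.

(** * The mean projector and its spectral gap *)

Section mean_projector.
Context (R : realType) (m n : nat) (A : 'M[R]_(m, n)).
Context (D : probability (sketch_space R m) R).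

(** The entries of an orthogonal projector are bounded by 1. *)
Lemma sketch_proj_integrable i j :
  D.-integrable setT (fun S => (sketch_proj A S i j)%:E).
Proof.
apply: (le_integrable _ _ _ (finite_measure_integrable_cst D 1 measurableT)) => //.
  by apply/measurable_EFinP; exact: sketch_proj_measurable.
by move=> S _; rewrite /= lee_fin normr1; exact: sketch_proj_coord_le1.
Qed.

Lemma WmxE i j : (Wmx A D i j)%:E = (\int[D]_S (sketch_proj A S i j)%:E)%E.
Proof.
rewrite mxE unlock fineK//.
by apply: integrable_fin_num => //; exact: sketch_proj_integrable.
Qed.

(** The entries of L Z N are linear in the entries of Z, so that expectations can
    be taken entrywise. *)
Lemma mulmx_pairE p q (L : 'M[R]_(p, n)) (Z : 'M[R]_n) (N : 'M[R]_(n, q)) i j :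
  (L *m Z *m N) i j = \sum_(l : 'I_n * 'I_n) L i l.1 * N l.2 j * Z l.1 l.2.
Proof.
rewrite mxE -(pair_bigA _ (fun a c => L i a * N c j * Z a c))/= exchange_big/=.
apply: eq_bigr => c _; rewrite mxE mulr_suml; apply: eq_bigr => a _.
by rewrite mulrAC.
Qed.

Lemma sketch_proj_mul_integrable p q (L : 'M[R]_(p, n)) (N : 'M[R]_(n, q)) i j :
  D.-integrable setT (fun S => ((L *m sketch_proj A S *m N) i j)%:E).
Proof.
under eq_fun do rewrite mulmx_pairE -sumEFin.
apply: integrable_sum => // l _; under eq_fun do rewrite EFinM.
by apply: integrableZl => //; exact: sketch_proj_integrable.
Qed.

Lemma integral_sketch_proj p q (L : 'M[R]_(p, n)) (N : 'M[R]_(n, q)) i j :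
  (\int[D]_S ((L *m sketch_proj A S *m N) i j)%:E =
   ((L *m Wmx A D *m N) i j)%:E)%E.
Proof.
rewrite mulmx_pairE -sumEFin.
under eq_integral do rewrite mulmx_pairE -sumEFin.
rewrite integral_sum// => [|l]; last first.
  under eq_fun do rewrite EFinM.
  by apply: integrableZl => //; exact: sketch_proj_integrable.
apply: eq_bigr => l _; under eq_integral do rewrite EFinM.
by rewrite integralZl ?EFinM ?WmxE//; exact: sketch_proj_integrable.
Qed.

Lemma quad_sketch_proj_integrable x :
  D.-integrable setT (fun S => (quad (sketch_proj A S) x)%:E).
Proof. exact: sketch_proj_mul_integrable. Qed.

Lemma integral_quad_sketch_proj x :
  (\int[D]_S (quad (sketch_proj A S) x)%:E = (quad (Wmx A D) x)%:E)%E.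
Proof. exact: integral_sketch_proj. Qed.

Lemma Wmx_sym : (Wmx A D)^T = Wmx A D.
Proof.
apply/matrixP => i j; rewrite mxE; apply: EFin_inj; rewrite !WmxE.
apply: eq_integral => S _; congr (_%:E).
by rewrite -[in RHS](sketch_proj_sym A S) [RHS]mxE.
Qed.

Lemma quad_Wmx_ge0 x : 0 <= quad (Wmx A D) x.
Proof.
rewrite -lee_fin -integral_quad_sketch_proj; apply: integral_ge0 => S _.
by rewrite lee_fin quad_sketch_proj_ge0.
Qed.

Lemma integral_sqnorm_sub_sketch_proj x :
  (\int[D]_S (sqnorm (x - sketch_proj A S *m x))%:E =
   (sqnorm x - quad (Wmx A D) x)%:E)%E.
Proof.
under eq_integral do rewrite sqnorm_sub_sketch_proj EFinB.
rewrite (integralB _ (finite_measure_integrable_cst D (sqnorm x) measurableT)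
  (quad_sketch_proj_integrable x))//.
rewrite integral_quad_sketch_proj (integral_cst D measurableT (sqnorm x)%:E).
rewrite [X in (_ * X)%E](_ : _ = 1%E); last exact: probability_setT.
by rewrite mule1 EFinB.
Qed.

Lemma quad_Wmx_le x : quad (Wmx A D) x <= sqnorm x.
Proof.
rewrite -subr_ge0 -lee_fin -integral_sqnorm_sub_sketch_proj.
by apply: integral_ge0 => S _; rewrite lee_fin sqnorm_ge0.
Qed.

Lemma Wmx_range p (B : 'M[R]_(p, n)) : B *m A^T = 0 -> B *m Wmx A D = 0.
Proof.
move=> BA; apply/matrixP => i j; rewrite -[B *m _]mulmx1 [RHS]mxE.
apply: EFin_inj; rewrite -integral_sketch_proj integral0_eq// => S _.
by rewrite mulmx1 /sketch_proj !mulmxA BA !mul0mx mxE.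
Qed.

End mean_projector.

Section spectral_gap.
Context (R : realType) (m n : nat) (A : 'M[R]_(m, n)) (b : 'cV[R]_m).
Context (D : probability (sketch_space R m) R).
Hypothesis exactness : minimizers (fobj A b D) = solution_set A b.
Context (xs : 'cV[R]_n) (Axs : A *m xs = b).

Lemma fobj_quad x : fobj A b D x = (2^-1 * quad (Wmx A D) (x - xs))%:E.
Proof.
rewrite /fobj unlock; under eq_integral do rewrite (fS_quad Axs) EFinM.
rewrite integralZl//; last exact: quad_sketch_proj_integrable.
by rewrite integral_quad_sketch_proj EFinM.
Qed.

(** The only use of exactness: f(xs + e) = e^T W e / 2 is then the minimal value 0,
    so xs + e minimizes f and therefore solves the system. *)
Lemma quad_Wmx_eq0 e : quad (Wmx A D) e = 0 -> A *m e = 0.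
Proof.
move=> We; have : solution_set A b (xs + e).
  rewrite -exactness => y; rewrite !fobj_quad addrC addKr We mulr0 lee_fin.
  by rewrite mulr_ge0// quad_Wmx_ge0.
by rewrite /solution_set/= mulmxDr Axs => /eqP; rewrite addrC -subr_eq0 addrK => /eqP.
Qed.

Let B := kermx A^T.

(** The kernel of B = kermx A^T is the row space of A, the orthogonal complement
    of ker A. *)
Lemma row_space_ker0 (e : 'cV[R]_n) : B *m e = 0 -> A *m e = 0 -> e = 0.
Proof.
move=> Be Ae; have /submxP[y ey] : (e^T <= B)%MS.
  by apply/sub_kermxP; rewrite -trmx_mul Ae trmx0.
by apply/eqP; rewrite -sqnorm_eq0 /sqnorm ey -mulmxA Be mulmx0 mxE.
Qed.

(** On the row space of A the form of W is positive definite, since a zero would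
    lie in ker A as well; the minimum of its Rayleigh quotient there is thus a
    nonzero eigenvalue, bounded by 1 because W is an average of projectors. *)
Lemma lambda_min_pos_gap : A != 0 ->
  lambda_min_pos (Wmx A D) <= 1 /\
  forall e : 'cV[R]_n, B *m e = 0 ->
    lambda_min_pos (Wmx A D) * sqnorm e <= quad (Wmx A D) e.
Proof.
move=> A0; set W := Wmx A D.
have BA : B *m A^T = 0 by exact: mulmx_ker.
have U0 : exists2 x : 'cV[R]_n, x != 0 & B *m x = 0.
  move/matrix0Pn : A0 => [i [j Aij]]; exists (col i A^T).
    by apply/matrix0Pn; exists j, 0; rewrite !mxE.
  by rewrite colE mulmxA BA mul0mx.
have [x [x1 Bx] xmin] := rayleigh_attained W U0.
have WB (y : 'cV[R]_n) : B *m y = 0 -> B *m (W *m y) = 0.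
  by rewrite mulmxA Wmx_range// mul0mx.
have Wx : eigenvalue W (quad W x).
  exact: (rayleigh_eigenvalue (Wmx_sym A D) WB x1 Bx xmin).
have Wx0 : quad W x != 0.
  apply/eqP => /quad_Wmx_eq0 Ax; have := row_space_ker0 Bx Ax.
  by move/eqP; rewrite -sqnorm_eq0 x1 oner_eq0.
have lam_le : lambda_min_pos W <= quad W x.
  by apply: lambda_min_pos_le => //; [exact: Wmx_sym|exact: quad_Wmx_ge0].
split=> [|e Be]; first by rewrite (le_trans lam_le)// -x1 quad_Wmx_le.
by rewrite (le_trans _ (xmin _ Be))// ler_wpM2r// sqnorm_ge0.
Qed.

(** Perturbing the nearest point xs inside the solution set, along u in ker A,
    shows that x0 - xs is orthogonal to ker A. *)
Lemma projection_error x0 : is_projection (solution_set A b) x0 xs ->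
  B *m (x0 - xs) = 0.
Proof.
move=> [_ xs_min]; set e := x0 - xs.
have ortho (u : 'cV[R]_n) : A *m u = 0 -> (e^T *m u) 0 0 = 0.
  move=> Au; set c := (e^T *m u) 0 0.
  have emin t : 0 <= t ^+ 2 * sqnorm u - 2 * t * c.
    have : solution_set A b (xs + t *: u).
      by rewrite /solution_set/= mulmxDr -scalemxAr Au scaler0 addr0.
    move/xs_min; rewrite opprD addrA -/e -ler_sqr ?nnegrE ?sqrtr_ge0//.
    rewrite !enorm_sqr (sqnormB e) sqnormZ -scalemxAr.
    have -> : (t *: (e^T *m u)) 0 0 = t * c by rewrite mxE.
    by rewrite -subr_ge0; congr (0 <= _); ring.
  (* The exact minimizer is c / |u|^2; adding 1 covers u = 0. *)
  have := emin (c / (sqnorm u + 1)); have su := sqnorm_ge0 u.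
  have s1 : 0 < sqnorm u + 1 by lra.
  set s := sqnorm u in su s1 *; set r := c / (s + 1).
  have cE : c = r * (s + 1) by rewrite /r divfK// gt_eqF.
  rewrite cE => rs; have r2 : r ^+ 2 <= 0 by nra.
  have : r == 0 by rewrite -sqrf_eq0 eq_le r2 sqr_ge0.
  by move/eqP ->; rewrite mul0r.
apply/matrixP => i j; rewrite ord1 [RHS]mxE.
have Ar : A *m (row i B)^T = 0.
  by apply: trmx_inj; rewrite trmx_mul trmxK -row_mul mulmx_ker row0 trmx0.
rewrite -[RHS](ortho _ Ar) dotmxC trmxK -row_mul.
by rewrite [RHS]mxE.
Qed.

End spectral_gap.

(** * Contraction in mean square *)

Section sgd_contraction.
Context (R : realType) (m n : nat) (A : 'M[R]_(m, n)) (b : 'cV[R]_m).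
Context (xs : 'cV[R]_n) (Axs : A *m xs = b) (x0 : 'cV[R]_n).

(** Every step subtracts a vector of the row space of A, so the error never leaves
    it. *)
Lemma sgd_error_ker0 p (B : 'M[R]_(p, n)) (S : nat -> sketch R m) k :
  B *m A^T = 0 -> B *m (x0 - xs) = 0 -> B *m (sgd A b x0 S k - xs) = 0.
Proof.
move=> BA Be0; elim: k => [//|k IHk].
by rewrite (sgd_error Axs) mulmxBr IHk /sketch_proj !mulmxA BA !mul0mx subr0.
Qed.

Context (D : probability (sketch_space R m) R).
Context (d : measure_display) (Omega : measurableType d) (P : probability Omega R).
Context (S : nat -> {RV P >-> sketch_space R m}).

Let err k w := sgd A b x0 (fun i => S i w) k - xs.

Lemma sgd_error_past_measurable k :
  mx_measurable (fun w : past S k => err k w).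
Proof.
elim: k => [|k IHk]; first by move=> i j; exact: (measurable_cst ((x0 - xs) i j)).
rewrite /err; under eq_fun do rewrite (sgd_error Axs).
have mk : mx_measurable (fun w : past S k.+1 => err k w).
  by move=> i j; apply: past_measurable_funS; exact: IHk.
apply: mx_measurableB => //; apply: mx_measurableM => // i j.
exact: (measurableT_comp (sketch_proj_measurable A i j)
  (@past_measurable_fun _ _ _ _ _ _ S _ _ (ltnSn k))).
Qed.

(** Conditionally on the past, Pythagoras gives |e|^2 - e^T Z e, and averaging over
    the fresh sketch replaces Z by W. *)
Lemma expected_sgd_step k : mutually_independent S -> has_law D (S k) ->
  (\int[P]_w (sqnorm (err k.+1 w))%:E =
   \int[P]_w (sqnorm (err k w) - quad (Wmx A D) (err k w))%:E)%E.
Proof.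
move=> S_indep S_law.
pose f (z : past S k * sketch_space R m) :=
  (sqnorm (err k z.1 - sketch_proj A z.2 *m err k z.1))%:E.
transitivity (\int[P]_w f (w, S k w))%E.
  by apply: eq_integral => w _; rewrite /err (sgd_error Axs).
rewrite (integral_past_fresh S_indep S_law).
- by apply: eq_integral => w _; rewrite -integral_sqnorm_sub_sketch_proj.
- apply/measurable_EFinP; apply: measurable_sqnorm.
  have merr : mx_measurable
      (fun z : past S k * sketch_space R m => err k z.1).
    move=> i j; exact: (measurableT_comp (sgd_error_past_measurable i j)
      measurable_fst).
  apply: mx_measurableB => //; apply: mx_measurableM => // i j.
  exact: (measurableT_comp (sketch_proj_measurable A i j) measurable_snd).
- by move=> z; rewrite lee_fin sqnorm_ge0.
Qed.

End sgd_contraction.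

Theorem theoremB3 (R : realType) (m n : nat) (A : 'M[R]_(m, n)) (b : 'cV[R]_m)
  (A_neq0 : A != 0)
  (consistent : exists x : 'cV[R]_n, A *m x = b)
  (D : probability (sketch_space R m) R)
  (exactness : minimizers (fobj A b D) = solution_set A b)
  (d : measure_display) (Omega : measurableType d) (P : probability Omega R)
  (S : nat -> {RV P >-> sketch_space R m})
  (S_law : forall k : nat, has_law D (S k))
  (S_indep : mutually_independent S)
  (x0 xstar : 'cV[R]_n)
  (xstar_proj : is_projection (solution_set A b) x0 xstar)
  (k : nat) :
  ('E_P[fun w => (enorm (sgd A b x0 (fun i => S i w) k - xstar) ^+ 2)%R]
    <= ((1 - lambda_min_pos (Wmx A D)) ^+ k * enorm (x0 - xstar) ^+ 2)%R%:E)%E.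
Proof.
have [Axs _] := xstar_proj.
have [lam_le1 gap] := lambda_min_pos_gap exactness Axs A_neq0.
have e0 := projection_error Axs xstar_proj.
set lam := lambda_min_pos _ in lam_le1 gap *.
have rate_ge0 : 0 <= 1 - lam by rewrite subr_ge0.
rewrite unlock; under eq_integral do rewrite enorm_sqr; rewrite enorm_sqr.
have merr j : mx_measurable
    (fun w : Omega => sgd A b x0 (fun i => S i w) j - xstar).
  move=> a c.
  have mpast : mx_measurable (fun w : past S j =>
      sgd A b x0 (fun i => S i w) j - xstar) by exact: sgd_error_past_measurable.
  exact: (measurableT_comp (mpast a c) (@past_measurable_id _ _ _ _ _ P S j)).
have msqnorm j := measurable_sqnorm (merr j).
elim: k => [|k IHk].
  rewrite expr0 mul1r (integral_cst P measurableT (sqnorm (x0 - xstar))%:E).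
  rewrite [X in (_ * X)%E](_ : _ = 1%E); last exact: probability_setT.
  by rewrite mule1.
rewrite (expected_sgd_step Axs x0 S_indep (S_law k)).
rewrite exprS -mulrA EFinM.
apply: le_trans (lee_wpmul2l _ IHk); last by rewrite lee_fin.
rewrite -ge0_integralZl//; last 2 first.
- by apply/measurable_EFinP; exact: msqnorm.
- by move=> w _; rewrite lee_fin sqnorm_ge0.
apply: ge0_le_integral => //.
- by move=> w _; rewrite lee_fin subr_ge0 quad_Wmx_le.
- apply/measurable_EFinP; apply: measurable_funB; first exact: msqnorm.
  exact: measurable_quad.
- apply/measurable_EFinP; apply: measurable_funM; last exact: msqnorm.
  exact: measurable_cst.
move=> w _; rewrite -EFinM lee_fin mulrBl mul1r lerD2l lerN2; apply: gap.
by apply: (sgd_error_ker0 Axs) => //; exact: mulmx_ker.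
Qed.
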